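(* Let $1<p\le q\le\infty$, let $u,v$ be weights, let $\varphi:(0,\infty)\to(0,\infty)$ be a bijective function of class $C^1$, let $s_1,s_2,w_1,w_2$ be nonnegative functions on $(0,\infty)$, and let $Tf(y)=\int_0^\infty f(x)K(x,y)\,dx$, $y>0$, where the kernel $K$ satisfies $$K(x,y)\asymp\begin{cases} s_1(x)w_1(y), & x\in(0,\varphi(y)),\\ s_2(x)w_2(y), & x\in(\varphi(y),\infty).\end{cases}$$ Assume that $s_1v^{-1}\in L_{p'}(0,r)$ and $s_2v^{-1}\in L_{p'}(r,\infty)$ for every $r>0$. Then the weighted norm inequality $$\|Tf\|_{L_q^u}\le C\|f\|_{L_p^v}\quad\text{for every } f\in L_p^v,$$ with some constant $C>0$ independent of $f$, holds if and only if both $$\sup_{r>0}\|w_1u\|_{L_q(\varphi^{-1}(r,\infty))}\,\|s_1v^{-1}\|_{L_{p'}(0,r)}<\infty$$ and $$\sup_{r>0}\|w_2u\|_{L_q(\varphi^{-1}(0,r))}\,\|s_2v^{-1}\|_{L_{p'}(r,\infty)}<\infty.$$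
   Context: A weight is a positive locally integrable function on $\mathbb{R}_+=(0,\infty)$. For $1\le p\le\infty$, $p'$ is the Hölder conjugate ($\frac1p+\frac1{p'}=1$). For a measurable set $E\subset\mathbb{R}_+$, $\|f\|_{L_p(E)}=(\int_E|f|^p\,dx)^{1/p}$, and $\|f\|_{L_p^v}=\left(\int_0^\infty v(x)^p|f(x)|^p\,dx\right)^{1/p}$, with the obvious modification for $p=\infty$ (i.e. $\|f\|_{L_\infty^v}=\operatorname{ess\,sup} v|f|$); $L_p^v$ is the space of measurable $f$ with $\|f\|_{L_p^v}<\infty$. $A\asymp B$ means $cB\le A\le C'B$ with constants $c,C'>0$ independent of the variables ($x$ and $y$ here). $\varphi^{-1}(a,b)$ denotes the image of the interval $(a,b)$ under $\varphi^{-1}$. All functions involved (including $K$) are measurable, and $0\cdot\infty$ is read as $0$. Standing assumption: functions $f$ to which $T$ is applied are such that $x\mapsto f(x)K(x,y)$ is integrable on compact subsets of $\mathbb{R}_+$ for every $y>0$ and $\lim_{N\to\infty}\int_0^N f(x)K(x,y)\,dx$ exists and is finite for every $y>0$. *)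

(* Defs.v *)
From HB Require Import structures.
From mathcomp Require Export all_boot all_order all_algebra.
From mathcomp Require Export all_classical all_reals all_analysis.

Set Implicit Arguments.
Unset Strict Implicit.
Unset Printing Implicit Defensive.

Import Order.TTheory GRing.Theory Num.Theory.
Import numFieldNormedType.Exports.
Local Open Scope classical_set_scope.
Local Open Scope ring_scope.

(* Functions on (0, +oo) are represented by functions R -> R; their values
   outside posR R are never used. *)
Definition posR (R : realType) : set R := `]0, +oo[.
Arguments posR : clear implicits.

Definition weight (R : realType) (w : R -> R) : Prop :=
  (forall x : R, 0 < x -> 0 < w x) /\ locally_integrable (posR R) w.

Definition nonneg_measurable (R : realType) (g : R -> R) : Prop :=
  (forall x : R, 0 < x -> 0 <= g x) /\ measurable_fun (posR R) g.

(* Extending by 0 outside E turns the norm over R into the norm over E, also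
   for p = +oo since the essential supremum is that of an absolute value. *)
Definition norm_on (R : realType) (p : \bar R) (E : set R) (f : R -> R)
    : \bar R :=
  Lnorm lebesgue_measure p (EFin \o patch (fun=> 0) E f).

Definition Lp_on (R : realType) (p : \bar R) (E : set R) (f : R -> R) : Prop :=
  measurable_fun E f /\ (norm_on p E f < +oo)%E.

Definition wnorm (R : realType) (p : \bar R) (w f : R -> R) : \bar R :=
  norm_on p (posR R) (fun x => w x * `|f x|).

Definition wLp (R : realType) (p : \bar R) (w f : R -> R) : Prop :=
  measurable_fun (posR R) f /\ (wnorm p w f < +oo)%E.

Definition bijective_C1 (R : realType) (phi : R -> R) : Prop :=
  set_bij (posR R) (posR R) phi /\
  forall x : R, 0 < x -> derivable phi x 1 /\ {for x, continuous (derive1 phi)}.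

Definition inv_image (R : realType) (phi : R -> R) (A : set R) : set R :=
  posR R `&` phi @^-1` A.

(* The kernel is unconstrained (apart from being measurable) on the curve
   x = phi y. *)
Definition kernel_equiv (R : realType) (K : R -> R -> R) (phi : R -> R)
    (s1 s2 w1 w2 : R -> R) : Prop :=
  exists c C : R, [/\ 0 < c, 0 < C & forall x y : R, 0 < x -> 0 < y ->
    (x < phi y -> c * (s1 x * w1 y) <= K x y <= C * (s1 x * w1 y)) /\
    (phi y < x -> c * (s2 x * w2 y) <= K x y <= C * (s2 x * w2 y))].

Definition truncated (R : realType) (K : R -> R -> R) (f : R -> R) (y N : R)
    : R :=
  \int[lebesgue_measure]_(x in `]0, N[) (f x * K x y).

(* Compact subsets of (0, +oo) stay away from 0, so integrability on ]0, N[ is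
   required separately: it is what gives the integral from 0 to N a meaning
   (Rintegral returns a junk value on non-integrable functions). *)
Definition admissible (R : realType) (K : R -> R -> R) (f : R -> R) : Prop :=
  forall y : R, 0 < y ->
  [/\ locally_integrable (posR R) (fun x => f x * K x y),
      forall N : R, 0 < N ->
        lebesgue_measure.-integrable `]0, N[ (fun x => (f x * K x y)%:E) &
      cvg (truncated K f y N @[N --> +oo])].

Definition transform (R : realType) (K : R -> R -> R) (f : R -> R) (y : R)
    : R :=
  lim (truncated K f y N @[N --> +oo]).

Definition weighted_inequality (R : realType) (p q : \bar R) (u v : R -> R)
    (K : R -> R -> R) : Prop :=
  exists C : R, 0 < C /\
    forall f, wLp p v f -> admissible K f ->
      (wnorm q u (transform K f) <= C%:E * wnorm p v f)%E.

(* Main.v *)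
Require Import Defs.
From mathcomp Require Import measurable_realfun ess_sup_inf real_interval.
From mathcomp Require Import ring lra.
Import Order.TTheory GRing.Theory Num.Theory.
Import numFieldNormedType.Exports.
Local Open Scope classical_set_scope.
Local Open Scope ring_scope.
Set Implicit Arguments.
Unset Strict Implicit.
Unset Printing Implicit Defensive.

(** The operator is reduced to two Hardy operators. For f in the weighted space
    put F1(r) = the integral of s1 |f| over (0, r) and F2(r) = the integral of
    s2 |f| over (r, oo). Hölder's inequality and the assumptions on s1/v and
    s2/v make both finite, hence f K(., y) is integrable on the whole half-line
    for each y ([kernel_integrable]). So every f of the space is admissible, Tf
    is an absolutely convergent integral, and up to constants
      |Tf(y)| <= w1(y) F1(phi y) + w2(y) F2(phi y)      ([transform_le]),
      Tf(y) >= each of these two terms, if f >= 0       ([transform_ge]).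
    The curve x = phi y, where K is arbitrary, is invisible: it meets each
    horizontal line in one point.

    Sufficiency is a Hardy inequality for each term ([hardy_chain]). It is
    proved for a chain of sets I r, the intervals (0, r) or (r, oo) here, and
    F(r) = the integral of sigma h over I r, with sigma = s/v and h = v |f|. As
    F is continuous, for each integer k below the supremum of log2 F there is
    r_k with F(r_k) = 2^k. Let G_k be I r_k minus I r_(k-1), where sigma h has
    integral 2^(k-1). A point y with 2^k < F(phi y) <= 2^(k+1) lies in the set
    J r_k of those y whose I (phi y) is strictly larger than I r_k, and there
      F(phi y) <= 2^(k+1) = 4 times the integral of sigma h over G_k
               <= 4 |sigma|_{p', I r_k} |h|_{p, G_k}.
    After multiplication by |w|_{q, J r_k} the assumed bound A appears, leaving
    4 A |h|_{p, G_k}. The sets G_k are disjoint, so the q-th powers sum up by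
    the inclusion of l^p in l^q, which is where p <= q enters; for q = oo one
    takes suprema instead ([Lnorm_le_of_blocks]).

    Necessity tests the inequality on the extremals of Hölder's inequality,
    f = sigma^(p'-1) / v on I r ([hoelder_extremal], [muckenhoupt_necessary]):
    on J r the function Tf is at least c w times |sigma|_{p', I r} |h|_p. *)

Local Notation cut E f := (patch (fun=> 0%R) E f).

(** * Norms of functions extended by zero *)

Section zero_extension.
Context d (T : measurableType d) (R : realType).
Variable mu : {measure set T -> \bar R}.

Lemma measurable_cut (E : set T) (f : T -> R) : measurable E ->
  measurable_fun E f -> measurable_fun setT (cut E f).
Proof. by move=> mE mf; apply/(measurable_restrictT f mE). Qed.

Lemma cut_ge0 (E : set T) (f : T -> R) : (forall x, E x -> 0 <= f x) ->
  forall x, 0 <= cut E f x.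
Proof. by move=> f0 x; rewrite patchE; case: ifPn => // /set_mem /f0. Qed.

Lemma cut_sub (E D : set T) (f : T -> R) :
  E `<=` D -> cut E (cut D f) = cut E f.
Proof.
move=> ED; apply/funext => x; rewrite !patchE.
by case: ifP => // /set_mem/ED/mem_set ->.
Qed.

Lemma integral_cut (E : set T) (f : T -> R) :
  (\int[mu]_(x in E) (f x)%:E = \int[mu]_x (cut E f x)%:E)%E.
Proof.
rewrite integral_mkcond; apply: eq_integral => x _.
by rewrite !patchE; case: ifP.
Qed.

Local Open Scope ereal_scope.

(** The integral of a nonnegative function is a supremum over the simple
    functions below it, so it is monotone even on non-measurable functions.
    This spares the proof that Tf is measurable. *)
Lemma le_lower_integral (D : set T) (f g : T -> \bar R) :
  (forall x, D x -> 0 <= f x) -> (forall x, D x -> f x <= g x) ->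
  \int[mu]_(x in D) f x <= \int[mu]_(x in D) g x.
Proof.
move=> f0 fg; rewrite !ge0_integralE//; last first.
  by move=> x Dx; rewrite (le_trans (f0 _ Dx))// fg.
apply: le_ereal_sup => /= _ [h hf <-].
exists h => //= x; apply: le_trans (hf x) _.
rewrite /patch; case: ifPn => // /set_mem Dx; exact: fg.
Qed.

Lemma le_Lnorm (p : \bar R) (f g : T -> \bar R) : 1 <= p ->
  (forall x, `|f x| <= `|g x|) -> 'N[mu]_p[f] <= 'N[mu]_p[g].
Proof.
case: p => [p p1|_|//] fg; rewrite unlock.
  rewrite lee_fin in p1; have p0 := le_trans ler01 p1.
  have ip : (0 <= p^-1)%R by rewrite invr_ge0.
  apply: (gt0_ler_poweR ip).
  - rewrite in_itv/= leey andbT; apply: integral_ge0 => *; exact: poweR_ge0.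
  - rewrite in_itv/= leey andbT; apply: integral_ge0 => *; exact: poweR_ge0.
  apply: le_lower_integral => [x _|x _]; first exact: poweR_ge0.
  by apply: gt0_ler_poweR; rewrite ?in_itv/= ?leey ?abse_ge0.
by case: ifP => // _; apply: le_ess_sup; exact: aeW.
Qed.

Lemma Lnorm_ler (p : \bar R) (f g : T -> R) : 1 <= p ->
  (forall x, `|f x| <= `|g x|)%R ->
  'N[mu]_p[EFin \o f] <= 'N[mu]_p[EFin \o g].
Proof. by move=> p1 fg; apply: le_Lnorm => // x /=; rewrite lee_fin. Qed.

Lemma le_Lnorm_cut (p : \bar R) (E F : set T) (f : T -> R) : (1 <= p)%E ->
  E `<=` F -> ('N[mu]_p[EFin \o cut E f] <= 'N[mu]_p[EFin \o cut F f])%E.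
Proof.
move=> p1 EF; apply: Lnorm_ler => // x; rewrite !patchE.
case: ifPn => [/set_mem/EF/mem_set ->//|_]; by rewrite normr0.
Qed.

Lemma LnormZ_ge0 (p : \bar R) (f : T -> R) (c : R) : 1 <= p -> (0 < c)%R ->
  measurable_fun setT f ->
  'N[mu]_p[EFin \o (fun x => c * f x)%R] = c%:E * 'N[mu]_p[EFin \o f].
Proof.
move=> p1 c0 mf; case: p p1 => [p p1|_|//]; rewrite unlock.
  rewrite lee_fin in p1; have p0 := lt_le_trans ltr01 p1.
  under eq_integral do
    rewrite /= normrM gtr0_norm// powRM ?(ltW c0)// EFinM.
  rewrite ge0_integralZl//; last 2 first.
  - apply/measurable_EFinP; apply: (measurableT_comp (measurable_powR _)).
    exact: measurableT_comp.
  - by rewrite lee_fin powR_ge0.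
  rewrite poweRM ?lee_fin ?powR_ge0//; last first.
    by apply: integral_ge0 => x _; rewrite lee_fin powR_ge0.
  by rewrite poweR_EFin -powRrM divff ?gt_eqF// powRr1// ltW.
case: ifP; last by rewrite mule0.
move=> m0; rewrite -ess_sup_pZl//; congr ess_sup; apply/funext => x /=.
by rewrite normrM EFinM gtr0_norm.
Qed.

Lemma Lnormy_le (f : T -> \bar R) (M : \bar R) : 0 <= M ->
  {ae mu, forall x, `|f x| <= M} -> 'N[mu]_+oo[f] <= M.
Proof. by move=> M0 fM; rewrite unlock; case: ifP => // _; exact/ess_supP. Qed.

Lemma Lnormy_ae (f : T -> \bar R) : {ae mu, forall x, `|f x| <= 'N[mu]_+oo[f]}.
Proof.
rewrite unlock; case: ifPn => [_|]; first exact: ess_sup_ge.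
rewrite -leNgt measure_le0 => /eqP mu0.
by exists setT; split.
Qed.

Lemma poweR_Lnorm_cut (p : R) (E : set T) (f : T -> R) : (0 < p)%R ->
  'N[mu]_p%:E[EFin \o cut E f] `^ p = \int[mu]_(x in E) (`|f x| `^ p)%:E.
Proof.
move=> p0; rewrite poweR_Lnorm ?gt_eqF// [in RHS]integral_mkcond.
apply: eq_integral => x _; rewrite /= !patchE; case: ifP => // _.
by rewrite normr0 powR0 ?gt_eqF.
Qed.

End zero_extension.

(** Comparing q-th powers of norms avoids the outer exponent 1/q. *)
Lemma le_poweR_inv (R : realType) (r : R) (x y : \bar R) : 0 < r ->
  (0 <= x -> 0 <= y -> x `^ r <= y `^ r -> x <= y)%E.
Proof.
move=> r0 x0 y0 xy; have rN : r * r^-1 = 1 by rewrite divff ?gt_eqF.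
rewrite -(poweRe1 x0) -(poweRe1 y0) -rN !poweRrM.
by apply: gt0_ler_poweR; rewrite ?in_itv/= ?leey ?poweR_ge0// invr_ge0 ltW.
Qed.

(** * Hölder's inequality and its extremals for extended exponents *)

Lemma hoelder_conjugate_fin (R : realType) (p : R) : 1 < p ->
  exists p' : R, [/\ hoelder_conjugate p%:E = p'%:E, 1 < p',
    p^-1 + p'^-1 = 1 & (p' - 1) * p = p'].
Proof.
move=> p1; have p0 : 0 < p by exact: lt_trans p1.
have pB : 0 < p - 1 by rewrite subr_gt0.
exists (p / (p - 1)); split.
- rewrite /hoelder_conjugate/= eqe gt_eqF// inver subr_eq0 (gt_eqF p1).
  by rewrite EFinM.
- by rewrite ltr_pdivlMr// mul1r ltrBlDr ltrDl.
- by rewrite invf_div mulrBl mul1r divff ?gt_eqF// addrC subrK.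
- rewrite -[X in _ - X](divff (lt0r_neq0 pB)) -mulrBl opprB addrC subrK.
  by rewrite mul1r mulrC.
Qed.

Section hoelder_extended.
Context d (T : measurableType d) (R : realType).
Variable mu : {measure set T -> \bar R}.
(** At p = oo the bound holds with the constant |g|_oo inside the integral,
    which is then pulled out; this is valid also when that constant is
    infinite. *)
Lemma hoelder_ereal (p : \bar R) (f g : T -> R) : (1 < p)%E ->
  measurable_fun setT f -> measurable_fun setT g ->
  (\int[mu]_x (`|f x| * `|g x|)%:E <=
   'N[mu]_(hoelder_conjugate p)[EFin \o f] * 'N[mu]_p[EFin \o g])%E.
Proof.
move=> + mf mg; have mf' : measurable_fun setT (fun x => `|f x|%:E).
  by apply/measurable_EFinP; exact: measurableT_comp.
case: p => [p|_|//].
  rewrite lte_fin => p1; have [p' [-> p'1 pp' _]] := hoelder_conjugate_fin p1.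
  apply: le_trans (hoelder _ _ _ _ _ _) => //; rewrite ?(lt_trans ltr01)//.
    by rewrite Lnorm1; under [leRHS]eq_integral do rewrite /= normrM.
  by rewrite addrC.
rewrite hoelder_conjugatey Lnorm1 -ge0_integralZr//; last exact: Lnorm_ge0.
(* The sup norm is 0 by convention when the whole space is null. *)
have [mu0|mu0] := eqVneq (mu setT) 0%E.
  rewrite null_set_integral//; first by apply: integral_ge0 => x _;
    rewrite mule_ge0// ?lee_fin// Lnorm_ge0.
  by apply/measurable_EFinP/measurable_funM; exact: measurableT_comp.
apply: ae_ge0_le_integral => //.
- by apply/measurable_EFinP/measurable_funM; exact: measurableT_comp.
- by move=> x _; rewrite mule_ge0// ?lee_fin// Lnorm_ge0.
- by apply: emeasurable_funM => //; exact: measurable_cst.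
rewrite unlock lt0e mu0 measure_ge0.
apply: filterS (ess_sup_ge mu (abse \o EFin \o g)%E) => x /= gx _.
by rewrite EFinM lee_wpmul2l.
Qed.

Lemma hoelder_on (p : \bar R) (E : set T) (f g : T -> R) : (1 < p)%E ->
  measurable E -> measurable_fun E f -> measurable_fun E g ->
  (\int[mu]_(x in E) (`|f x| * `|g x|)%:E <=
   'N[mu]_(hoelder_conjugate p)[EFin \o cut E f] * 'N[mu]_p[EFin \o cut E g])%E.
Proof.
move=> p1 mE mf mg; apply: le_trans; last first.
  by apply: hoelder_ereal => //; exact: measurable_cut.
rewrite integral_cut; apply: le_lower_integral => x _.
  by rewrite patchE; case: ifP => //; rewrite lee_fin mulr_ge0.
by rewrite lee_fin !patchE; case: ifP => //; rewrite normr0 mul0r.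
Qed.

(** Equality holds for h = sigma^(p'-1): both sigma h and h^p equal sigma^p',
    since (p'-1) p = p'. At p = oo this function is the constant 1. The number
    L bounds the norm of h, and V L is the product of the two norms. *)
Lemma hoelder_extremal (p : \bar R) (E : set T) (sigma : T -> R) (V : R) :
  (1 < p)%E -> measurable E -> measurable_fun E sigma ->
  (forall x, E x -> 0 <= sigma x) -> 0 < V ->
  ('N[mu]_(hoelder_conjugate p)[EFin \o cut E sigma] = V%:E)%E ->
  exists (h : T -> R) (L : R),
    [/\ measurable_fun E h, forall x, 0 <= h x, 0 < L,
        ('N[mu]_p[EFin \o cut E h] <= L%:E)%E &
        (\int[mu]_(x in E) (sigma x * h x)%:E = (V * L)%:E)%E].
Proof.
move=> + mE msigma sigma0 V0; case: p => [p|_|//].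
  rewrite lte_fin => p1; have [p' [-> p'1 _ pp']] := hoelder_conjugate_fin p1.
  have p0 : 0 < p := lt_trans ltr01 p1.
  have p'0 : 0 < p' := lt_trans ltr01 p'1.
  move=> NV.
  have IV : (\int[mu]_(x in E) (`|sigma x| `^ p')%:E = (V `^ p')%:E)%E.
    by rewrite -poweR_Lnorm_cut// NV.
  exists (fun x => `|sigma x| `^ (p' - 1)), (V `^ (p' - 1)); split.
  - apply: (measurableT_comp (measurable_powR _)).
    exact: measurableT_comp.
  - by move=> x; exact: powR_ge0.
  - exact: powR_gt0.
  - apply: (le_poweR_inv p0); rewrite ?Lnorm_ge0 ?lee_fin ?powR_ge0//.
    rewrite poweR_Lnorm_cut// poweR_EFin -powRrM pp' -IV le_eqVlt.
    apply/orP; left; apply/eqP; apply: eq_integral => x _.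
    by rewrite ger0_norm ?powR_ge0// -powRrM pp'.
  - rewrite mulr_powRB1 ?(ltW V0)// -IV; apply: eq_integral => x /set_mem Ex.
    by rewrite -[in LHS](@ger0_norm _ (sigma x)) ?sigma0// normr_id mulr_powRB1.
rewrite hoelder_conjugatey => NV.
exists (fun=> 1), 1; split => //.
- apply: Lnormy_le => //; apply: aeW => x /=.
  by rewrite patchE; case: ifP; rewrite ?normr1 ?normr0 ?lee_fin.
- rewrite mulr1 -NV Lnorm1 integral_cut; apply: eq_integral => x _.
  rewrite /= !patchE; case: ifPn => [/set_mem Ex|_]; last by rewrite normr0.
  by rewrite mulr1 ger0_norm ?sigma0.
Qed.

End hoelder_extended.

(** * Summation over dyadic blocks *)

(** The levels are the powers 2^k with k an integer, enumerated by the natural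
    numbers so that countable sums and unions apply to them. Distinct levels
    differ at least by a factor 2, and the intervals from t n to 2 (t n) cover
    the positive numbers. *)
Lemma dyadic_levels (R : realType) : exists t : nat -> R,
  [/\ forall n, 0 < t n,
      forall n m, n != m -> t n <= t m / 2 \/ t m <= t n / 2 &
      forall x, 0 < x -> exists n, t n < x <= 2 * t n].
Proof.
(* A bijection from nat to int: even numbers to k >= 0, odd ones to k < 0. *)
pose e n : int := if odd n then Negz n./2 else Posz n./2.
have e_inj : injective e.
  move=> n m; rewrite /e; have := odd_double_half n; have := odd_double_half m.
  by case: (odd n); case: (odd m) => //= mE nE -[nm]; rewrite -mE -nE nm.
have e_surj k : exists n, e n = k.
  case: k => n; [exists n.*2|exists n.*2.+1].
    by rewrite /e odd_double/= doubleK.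
  by rewrite /e /= odd_double/= uphalf_double.
have half k : 2 `^ (k%:~R - 1) = 2 `^ k%:~R / 2 :> R.
  by rewrite powRD ?pnatr_eq0 ?implybT// powR_inv1.
exists (fun n => 2 `^ (e n)%:~R); split.
- by move=> n; rewrite powR_gt0.
- move=> n m nm; have : e n != e m by apply: contra nm => /eqP/e_inj ->.
  rewrite neq_lt => /orP[] enm; [left|right];
    by rewrite -half ler_powR ?ler1n// lerBrDr -intrD1 ler_int lezD1.
- move=> x x0; have ln2 : 0 < ln (2 : R) by rewrite ln_gt0// ltr1n.
  have xE : x = expR (ln x / ln 2 * ln 2) by rewrite divfK ?gt_eqF// lnK.
  have [n en] := e_surj (Num.ceil (ln x / ln 2) - 1).
  have /andP[lo up] := Num.Theory.ceil_itv (ln x / ln 2).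
  exists n; rewrite en {2 3}xE /powR pnatr_eq0/= ltr_expR ltr_pM2r// lo/=.
  rewrite -[X in X * expR _](lnK (x := 2)) ?posrE//.
  rewrite -expRD ler_expR -[X in X + _]mul1r -mulrDl ler_pM2r//.
  by rewrite intrB addrC subrK.
Qed.

(** The inclusion of l^1 in l^s: with B the sum, b_n^s <= b_n B^(s-1). *)
Lemma nneseries_poweR_le (R : realType) (b : nat -> \bar R) (s : R) : 1 <= s ->
  (forall n, 0 <= b n)%E ->
  (\sum_(n <oo) (b n `^ s) <= (\sum_(n <oo) b n) `^ s)%E.
Proof.
move=> s1 b0; have s0 : 0 < s by exact: lt_le_trans s1.
set B := (\sum_(n <oo) b n)%E.
have B0 : (0 <= B)%E by exact: nneseries_ge0.
have [->|Boo] := eqVneq B +oo%E; first by rewrite poweRyr ?gt_eqF// leey.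
have bB n : (b n <= B)%E.
  by rewrite /B (@nneseriesD1 _ b n xpredT)// leeDl// nneseries_ge0.
have [B' BE] : exists B' : R, B = B'%:E.
  by exists (fine B); rewrite fineK// ge0_fin_numE// ltey.
have B'0 : 0 <= B' by rewrite -lee_fin -BE.
rewrite BE poweR_EFin -mulr_powRB1// mulrC EFinM -BE /B -nneseriesZl//.
apply: lee_nneseries => n; first by move=> *; exact: poweR_ge0.
move=> _; have := bB n; have := b0 n; rewrite BE.
case: (b n) => [r| |]//; rewrite !lee_fin => r0 rB.
rewrite -mulr_powRB1// mulrC ler_wpM2r//.
by rewrite ge0_ler_powR// subr_ge0.
Qed.

Section discrete_to_norm.
Context d1 (T : measurableType d1) d2 (S : measurableType d2) (R : realType).
Variables (mu : {measure set T -> \bar R}) (nu : {measure set S -> \bar R}).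

(** If u is dominated at each point by one of the functions lam n * w on B n,
    then u^q is dominated by the sum of their q-th powers; so the sets B n may
    overlap, unlike the sets G n on which h is localized. *)
Lemma Lnorm_le_of_blocks (p q : \bar R) (h : T -> R) (w u : S -> R) (c : R)
    (lam : nat -> R) (G : nat -> set T) (B : nat -> set S) :
  (1 <= p)%E -> (p <= q)%E -> 0 <= c ->
  measurable_fun setT h -> measurable_fun setT w -> (forall y, 0 <= w y) ->
  (forall n, 0 < lam n) -> (forall n, measurable (B n)) ->
  (forall n, measurable (G n)) -> trivIset setT G ->
  (forall n, (lam n)%:E * 'N[nu]_q[EFin \o cut (B n) w] <=
             c%:E * 'N[mu]_p[EFin \o cut (G n) h])%E ->
  (forall y, 0 <= u y) ->
  (forall y, u y != 0 -> exists2 n, B n y & u y <= lam n * w y) ->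
  ('N[nu]_q[EFin \o u] <= c%:E * 'N[mu]_p[EFin \o h])%E.
Proof.
move=> p1 pq c0 mh mw w0 lam0 mB mG tG block u0 uB.
(* Norms over the whole space, in the form used for norms over a set. *)
have hE : h = cut setT h by apply/funext => x; rewrite patchE in_setT.
have q1 : (1 <= q)%E := le_trans p1 pq.
have RHS0 : (0 <= c%:E * 'N[mu]_p[EFin \o h])%E.
  by rewrite mule_ge0 ?lee_fin// Lnorm_ge0.
case: q q1 pq block => [q||//] q1 pq block; last first.
  apply: Lnormy_le => //.
  have := @ae_foralln _ _ _ nu (fun n y =>
    (`|(EFin \o cut (B n) w) y| <= 'N[nu]_+oo[EFin \o cut (B n) w])%E).
  move=> /(_ (fun n => Lnormy_ae nu _)); apply: filterS => y wy /=.
  have [/eqP ->|/uB[n Bn un]] := boolP (u y == 0); first by rewrite normr0.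
  rewrite ger0_norm//; apply: (@le_trans _ _ (lam n * w y)%:E).
    by rewrite lee_fin.
  have := wy n; rewrite /= patchE mem_set//= ger0_norm// => wn.
  rewrite EFinM; apply: le_trans.
    by apply: lee_wpmul2l wn; rewrite lee_fin ltW.
  apply: le_trans (block n) _; apply: lee_wpmul2l; first by rewrite lee_fin.
  by rewrite [in leRHS]hE; exact: le_Lnorm_cut.
case: p p1 pq block RHS0 => [p||//] p1 pq block RHS0; last first.
  by rewrite leye_eq in pq.
rewrite lee_fin in p1; rewrite lee_fin in pq; rewrite lee_fin in q1.
have p0 : 0 < p by exact: lt_le_trans p1.
have q0 : 0 < q by exact: lt_le_trans q1.
apply: (le_poweR_inv q0) => //; first exact: Lnorm_ge0.
rewrite poweR_Lnorm ?gt_eqF//.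
apply: (@le_trans _ _
  (\int[nu]_y \sum_(n <oo) ((lam n * cut (B n) w y) `^ q)%:E)%E).
  apply: le_lower_integral => y _; first exact: poweR_ge0.
  have nn n : (0 <= ((lam n * cut (B n) w y) `^ q)%:E)%E.
    by rewrite lee_fin powR_ge0.
  have [/eqP u_eq0|/uB[n Bn un]] := boolP (u y == 0).
    by rewrite /= u_eq0 normr0 powR0 ?gt_eqF// nneseries_ge0.
  rewrite (@nneseriesD1 _ _ n xpredT)//.
  apply: le_trans (leeDl _ _); last by rewrite nneseries_ge0.
  rewrite /= lee_fin ger0_norm// patchE mem_set//.
  by apply: ge0_ler_powR; rewrite ?nnegrE ?(ltW q0)//; exact: le_trans un.
have mBw n : measurable_fun setT (cut (B n) w).
  by apply: measurable_cut => //; exact: measurable_funTS.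
have Bw0 n y : 0 <= cut (B n) w y by apply: cut_ge0.
rewrite integral_nneseries//; first last.
- by move=> n y _; rewrite lee_fin powR_ge0.
- move=> n; apply/measurable_EFinP.
  apply: (measurableT_comp (measurable_powR _)).
  exact: measurable_funM.
apply: (@le_trans _ _
  (\sum_(n <oo) ((c `^ q)%:E * ('N[mu]_p%:E[EFin \o cut (G n) h] `^ p) `^ (q / p)))%E).
  apply: lee_nneseries => n *.
    by apply: integral_ge0 => y _; rewrite lee_fin powR_ge0.
  rewrite -poweRrM mulrC divfK ?gt_eqF// -poweR_EFin -poweRM ?lee_fin ?Lnorm_ge0//.
  rewrite [leLHS](_ : _ =
      ('N[nu]_q%:E[EFin \o (fun y => lam n * cut (B n) w y)%R] `^ q)%E).
    rewrite LnormZ_ge0//; apply: gt0_ler_poweR; rewrite ?in_itv/= ?leey ?andbT//.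
    - exact: ltW.
    - by rewrite mule_ge0 ?lee_fin ?(ltW (lam0 n))// Lnorm_ge0.
    - by rewrite mule_ge0 ?lee_fin// Lnorm_ge0.
  rewrite poweR_Lnorm ?gt_eqF//; apply: eq_integral => y _.
  by rewrite /= ger0_norm// mulr_ge0// ltW.
rewrite nneseriesZl; last by move=> *; exact: poweR_ge0.
rewrite poweRM ?lee_fin ?Lnorm_ge0// poweR_EFin.
apply: lee_wpmul2l; first by rewrite lee_fin powR_ge0.
apply: le_trans (nneseries_poweR_le _ _) _; [|by move=> *; exact: poweR_ge0|].
  by rewrite ler_pdivlMr// mul1r.
have qE : q = p * (q / p) by rewrite mulrC divfK ?gt_eqF.
rewrite [in leRHS]qE [leRHS]poweRrM.
apply: gt0_ler_poweR; rewrite ?in_itv/= ?leey ?poweR_ge0 ?andbT//.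
- by rewrite divr_ge0// ltW.
- by apply: nneseries_ge0 => *; exact: poweR_ge0.
rewrite [in leRHS]hE poweR_Lnorm_cut//.
under eq_eseriesr do rewrite poweR_Lnorm_cut//.
have mhp E : measurable_fun E (fun x => (`|h x| `^ p)%:E).
  apply/measurable_EFinP; apply: (measurableT_comp (measurable_powR _)).
  by apply: measurableT_comp => //; exact: measurable_funTS.
rewrite -ge0_integral_bigcup//.
by apply: ge0_subset_integral => //; exact: bigcupT_measurable.
Qed.

End discrete_to_norm.

(** * Hardy's inequality along a chain of sets *)

(** For Hardy's operator on the half-line, I r is the interval (0, r), phi is
    the change of variable, and J r collects the y with phi y > r. For the dual
    operator I r is (r, oo) and J r collects the y with phi y < r. Intervals
    enter through their nesting and through the intermediate value property
    [F_ivt], which is the continuity of r |-> F r in disguise. *)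
Section hardy.
Context d1 (T : measurableType d1) d2 (S : measurableType d2) (R : realType).
Variables (mu : {measure set T -> \bar R}) (nu : {measure set S -> \bar R}).
Variables (p q : \bar R) (sigma h : T -> R) (w : S -> R) (phi : S -> R).
Variables (I : R -> set T) (J : R -> set S) (D : set S) (A : R).
Hypotheses (p1 : (1 < p)%E) (pq : (p <= q)%E).
Hypotheses (msigma : measurable_fun setT sigma) (mh : measurable_fun setT h).
Hypotheses (sigma0 : forall x, 0 <= sigma x) (h0 : forall x, 0 <= h x).
Hypotheses (mw : measurable_fun setT w) (w0 : forall y, 0 <= w y).
Hypothesis mI : forall r : R, 0 < r -> measurable (I r).
Hypothesis mJ : forall r : R, 0 < r -> measurable (J r).
Hypothesis phiD : forall y, D y -> 0 < phi y.

Let F r := (\int[mu]_(x in I r) (sigma x * h x)%:E)%E.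

Hypothesis Ffin : forall r : R, 0 < r -> (F r < +oo)%E.
Hypothesis I_chain : forall r s : R, 0 < r -> 0 < s ->
  I r `<=` I s \/ I s `<=` I r.
Hypothesis I_J : forall (r : R) y, 0 < r -> D y -> ~ J r y ->
  I (phi y) `<=` I r.
Hypothesis F_ivt : forall r t : R, 0 < r -> 0 < t -> (t%:E < F r)%E ->
  exists2 s, 0 < s & F s = t%:E.
Hypothesis FA : forall r : R, 0 < r ->
  ('N[nu]_q[EFin \o cut (J r) w] *
   'N[mu]_(hoelder_conjugate p)[EFin \o cut (I r) sigma] <= A%:E)%E.

Let A0 : 0 <= A.
Proof.
by rewrite -lee_fin; apply: le_trans (FA ltr01); rewrite mule_ge0 ?Lnorm_ge0.
Qed.

Let F0 r : (0 <= F r)%E.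
Proof. by apply: integral_ge0 => x _; rewrite lee_fin mulr_ge0. Qed.

Let F_sub r s : I s `<=` I r -> (F s <= F r)%E.
Proof.
move=> sr; rewrite /F [leLHS]integral_cut [leRHS]integral_cut.
apply: le_lower_integral => x _.
  by rewrite lee_fin; apply: cut_ge0 => *; rewrite mulr_ge0.
rewrite lee_fin !patchE; case: ifPn => [/set_mem/sr/mem_set ->//|_].
by case: ifP => // _; rewrite mulr_ge0.
Qed.

Let F_incr r s : 0 < r -> 0 < s -> (F r < F s)%E -> I r `<=` I s.
Proof.
move=> r0 s0 Frs; have [//|/F_sub] := I_chain r0 s0.
by rewrite leNgt Frs.
Qed.

Let F_J r y : 0 < r -> D y -> (F r < F (phi y))%E -> J r y.
Proof.
move=> r0 Dy Fry; apply: contrapT => /(I_J r0 Dy)/F_sub.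
by rewrite leNgt Fry.
Qed.

(** The weights lam n are 2 (t n) = 4 (t n / 2), and t n / 2 is the integral of
    sigma h over G n, the part of I r gained when F goes from t n / 2 to t n.
    Levels that F does not attain get empty sets. *)
Lemma dyadic_discretization :
  exists (lam : nat -> R) (G : nat -> set T) (B : nat -> set S),
  [/\ [/\ forall n, 0 < lam n, forall n, measurable (B n),
          forall n, measurable (G n) & trivIset setT G],
      forall n, ((lam n)%:E * 'N[nu]_q[EFin \o cut (B n) w] <=
                 (4 * A)%:E * 'N[mu]_p[EFin \o cut (G n) h])%E &
      forall y, D y -> (0 < F (phi y))%E ->
        exists2 n, B n y & (F (phi y) <= (lam n)%:E)%E].
Proof.
have q1 : (1 <= q)%E by rewrite (le_trans _ pq)// ltW.
have [t [t0 tsep tcover]] := dyadic_levels R.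
(* The choice of r depends on the value of F only, so that G n and G m remain
   disjoint when one of the two blocks starts where the other ends. *)
have [rho rhoP] : {rho : R -> R & forall x, (exists2 s, 0 < s & F s = x%:E) ->
    0 < rho x /\ F (rho x) = x%:E}.
  apply: (@choice _ _ (fun x r => (exists2 s, 0 < s & F s = x%:E) ->
    0 < r /\ F r = x%:E)) => x.
  have [[s s0 Fs]|nex] := pselect (exists2 s, 0 < s & F s = x%:E).
    by exists s.
  by exists 0.
pose attained n := exists2 s, 0 < s & F s = (t n)%:E.
have rho1 n : attained n -> 0 < rho (t n) /\ F (rho (t n)) = (t n)%:E.
  exact: rhoP.
have th n : 0 < t n / 2 by rewrite divr_gt0.
have tht n : t n / 2 < t n by rewrite ltr_pdivrMr// ltr_pMr// ltr1n.
have rho2 n : attained n ->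
    0 < rho (t n / 2) /\ F (rho (t n / 2)) = (t n / 2)%:E.
  move=> /rho1[r0 Fr]; apply: rhoP; apply: F_ivt r0 _ _ => //.
  by rewrite Fr lte_fin.
pose G n := if pselect (attained n) then I (rho (t n)) `\` I (rho (t n / 2))
            else set0.
pose B n := if pselect (attained n) then J (rho (t n)) else set0.
exists (fun n => 2 * t n), G, B; split; first split.
- by move=> n; rewrite mulr_gt0.
- move=> n; rewrite /B; case: pselect => //= an; apply: mJ.
  by have [] := rho1 _ an.
- move=> n; rewrite /G; case: pselect => //= an; apply: measurableD; apply: mI.
    by have [] := rho1 _ an.
  by have [] := rho2 _ an.
- have disj n m x : t n <= t m / 2 -> G n x -> G m x -> False.
    rewrite /G; case: pselect => //= an; case: pselect => //= am.
    rewrite le_eqVlt => /predU1P[-> [Gn _] [_ Gm]//|tnm [Gn _] [_ Gm]].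
    apply: Gm; apply: F_incr Gn.
    + by have [] := rho1 _ an.
    + by have [] := rho2 _ am.
    + have [_ ->] := rho1 _ an; have [_ ->] := rho2 _ am.
      by rewrite lte_fin.
  move=> n m _ _ [x [Gn Gm]]; apply: contrapT => /eqP/tsep[] nm.
    exact: disj nm Gn Gm.
  exact: disj nm Gm Gn.
- move=> n; rewrite /B /G; case: pselect => /= [an|_]; last first.
    rewrite [X in 'N[nu]_q[X]%E](_ : _ = cst 0%E); last first.
      by apply/funext => y /=; rewrite patchE in_set0.
    rewrite Lnorm0 ?mule0; last by rewrite gt_eqF// (lt_le_trans _ q1).
    by rewrite mule_ge0 ?Lnorm_ge0// lee_fin mulr_ge0.
  have [r0 Fr] := rho1 _ an; have [r0' Fr'] := rho2 _ an.
  set r := rho (t n) in r0 Fr *; set r' := rho (t n / 2) in r0' Fr' *.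
  have II : I r' `<=` I r by apply: F_incr => //; rewrite Fr Fr' lte_fin.
  have mG : measurable (I r `\` I r') by apply: measurableD; exact: mI.
  have mg E : measurable_fun E (fun x => (sigma x * h x)%:E).
    by apply/measurable_EFinP/measurable_funM; exact: measurable_funTS.
  have FG : (\int[mu]_(x in I r `\` I r') (sigma x * h x)%:E = (t n / 2)%:E)%E.
    have : (F r = F r' + \int[mu]_(x in I r `\` I r') (sigma x * h x)%:E)%E.
      rewrite /F -ge0_integral_setU//; first last.
      - by apply/disj_setPS => x [? []].
      - by move=> x _; rewrite lee_fin mulr_ge0.
      - exact: mI.
      by rewrite setDUK.
    rewrite Fr Fr'; case: (\int[mu]_(x in _) _)%E => //= z.
    by rewrite -EFinD => -[]; rewrite [X in X = _](splitr (t n)) => /addrI ->.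
  have key : ((t n / 2)%:E <= 'N[mu]_(hoelder_conjugate p)[EFin \o cut (I r) sigma]
      * 'N[mu]_p[EFin \o cut (I r `\` I r') h])%E.
    rewrite -FG; apply: (@le_trans _ _
      (\int[mu]_(x in I r `\` I r') (`|sigma x| * `|h x|)%:E)%E).
      by apply: le_lower_integral => x _; rewrite lee_fin ?mulr_ge0// !ger0_norm.
    apply: le_trans (hoelder_on mu p1 mG _ _) _; [exact: measurable_funTS..|].
    rewrite lee_wpmul2r ?Lnorm_ge0//; apply: le_Lnorm_cut; last exact: subDsetl.
    by rewrite hoelder_conj_ge1// ltW.
  (* Hölder is applied on G n, but sigma is then measured on all of I r, to
     match the assumed bound. *)
  have -> : (2 * t n)%:E = (4%:E * (t n / 2)%:E)%E :> \bar R.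
    rewrite -EFinM; congr EFin; lra.
  rewrite (EFinM 4 A) -!muleA lee_pmul2l//; apply: le_trans.
    by apply: lee_wpmul2r key; exact: Lnorm_ge0.
  rewrite muleAC; apply: lee_wpmul2r; first exact: Lnorm_ge0.
  by rewrite muleC FA.
- move=> y Dy Fy; have py := phiD Dy.
  have [x xE] : exists x : R, F (phi y) = x%:E.
    by exists (fine (F (phi y))); rewrite fineK// ge0_fin_numE ?Ffin.
  rewrite xE lte_fin in Fy; have [n /andP[nx xn]] := tcover _ Fy.
  have an : attained n by apply: F_ivt py _ _ => //; rewrite xE lte_fin.
  have [r0 Fr] := rho1 _ an.
  exists n; last by rewrite xE lee_fin.
  rewrite /B; case: pselect => //= _; apply: F_J => //.
  by rewrite Fr xE lte_fin.
Qed.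

Lemma hardy_chain :
  ('N[nu]_q[EFin \o cut D (fun y => w y * fine (F (phi y)))%R] <=
   (4 * A)%:E * 'N[mu]_p[EFin \o h])%E.
Proof.
have [lam [G [B [[lam0 mB mG tG] block cover]]]] := dyadic_discretization.
apply: (Lnorm_le_of_blocks (ltW p1) pq _ mh mw w0 lam0 mB mG tG).
- by rewrite mulr_ge0.
- exact: block.
- by apply: cut_ge0 => y Dy; rewrite mulr_ge0// fine_ge0.
- move=> y; rewrite patchE; case: ifPn => [/set_mem Dy|_]; last by rewrite eqxx.
  rewrite mulf_eq0 negb_or => /andP[_ Fy].
  have Fpos : (0 < F (phi y))%E.
    by rewrite lt0e F0 andbT; apply: contraNneq Fy => ->.
  have [n Bn Fn] := cover _ Dy Fpos; exists n => //.
  rewrite mulrC ler_wpM2r// -lee_fin fineK// ge0_fin_numE//.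
  exact: Ffin (phiD Dy).
Qed.

End hardy.

(** * Integrals over subintervals of the half-line *)

Section interval_integrals.
Context (R : realType) (g : R -> R).
Hypotheses (mg : measurable_fun setT g) (g0 : forall x, 0 <= g x).
Local Notation mu := (@lebesgue_measure R).

Let mgE (D : set R) : measurable_fun D (fun x => (g x)%:E).
Proof. by apply/measurable_EFinP; exact: measurable_funTS. Qed.

Lemma integral_itv_ivt (a b v : R) : a <= b ->
  (\int[mu]_(x in `[a, b]) (g x)%:E < +oo)%E -> 0 <= v ->
  (v%:E <= \int[mu]_(x in `[a, b]) (g x)%:E)%E ->
  exists2 c, a <= c <= b & (\int[mu]_(x in `[a, c]) (g x)%:E = v%:E)%E.
Proof.
move=> ab goo v0 vb.
have ig : mu.-integrable `[a, b] (EFin \o g).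
  apply/integrableP; split; first exact: mgE.
  by under eq_integral do rewrite /= ger0_norm//.
have cont := parameterized_integral_continuous ab ig.
have pa : parameterized_integral mu a a g = 0.
  by rewrite /parameterized_integral set_itv1 Rintegral_set1.
have [|c] := IVT (v := v) ab cont.
  rewrite pa min_l ?max_r ?v0 /parameterized_integral/Rintegral//=.
  - rewrite -lee_fin fineK// ge0_fin_numE//.
    by apply: integral_ge0 => x _; rewrite lee_fin.
  - by rewrite fine_ge0//; apply: integral_ge0 => x _; rewrite lee_fin.
  - by rewrite fine_ge0//; apply: integral_ge0 => x _; rewrite lee_fin.
rewrite in_itv/= => /andP[ac cb] cv; exists c; first by rewrite ac cb.
rewrite -cv /parameterized_integral /Rintegral fineK// ge0_fin_numE.
  apply: le_lt_trans goo; apply: ge0_subset_integral => //.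
  - exact: mgE.
  - by move=> x _; rewrite lee_fin.
  - by apply: subset_itvl; rewrite bnd_simp.
by apply: integral_ge0 => x _; rewrite lee_fin.
Qed.

(** Here c = 0 is excluded because the integral over (0, c) is t > 0. *)
Lemma integral_left_ivt (r t : R) : 0 < r -> 0 < t ->
  (\int[mu]_(x in `]0%R, r[) (g x)%:E < +oo)%E ->
  (t%:E < \int[mu]_(x in `]0%R, r[) (g x)%:E)%E ->
  exists2 s, 0 < s & (\int[mu]_(x in `]0%R, s[) (g x)%:E = t%:E)%E.
Proof.
move=> r0 t0 goo tr.
have E s : (\int[mu]_(x in `[0%R, s]) (g x)%:E =
            \int[mu]_(x in `]0%R, s[) (g x)%:E)%E.
  by apply: integral_itv_bndoo; exact: mgE.
have [||c /andP[c0 cr] ct] := @integral_itv_ivt 0 r t (ltW r0) _ (ltW t0).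
- by rewrite E.
- by rewrite E ltW.
exists c; last by rewrite -E.
rewrite lt_neqAle c0 andbT; apply/negP => /eqP c0E.
by move: ct; rewrite -c0E set_itv1 integral_set1 => -[] /eqP; rewrite lt_eqF.
Qed.

(** The integral over (s, oo) is the total minus the integral over [r, s], so
    the target value for the latter is M - t; it is reached on a bounded
    interval because t > 0. *)
Lemma integral_right_ivt (r t : R) : 0 < r -> 0 < t ->
  (\int[mu]_(x in `]r, +oo[) (g x)%:E < +oo)%E ->
  (t%:E < \int[mu]_(x in `]r, +oo[) (g x)%:E)%E ->
  exists2 s, 0 < s & (\int[mu]_(x in `]s, +oo[) (g x)%:E = t%:E)%E.
Proof.
move=> r0 t0 goo tr.
have ge0 D : (0 <= \int[mu]_(x in D) (g x)%:E)%E.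
  by apply: integral_ge0 => x _; rewrite lee_fin.
have [M ME] : exists M : R, (\int[mu]_(x in `]r, +oo[) (g x)%:E = M%:E)%E.
  exists (fine (\int[mu]_(x in `]r, +oo[) (g x)%:E)%E).
  by rewrite fineK// ge0_fin_numE.
rewrite ME lte_fin in tr.
have ooE s : (\int[mu]_(x in `[s, +oo[) (g x)%:E =
            \int[mu]_(x in `]s, +oo[) (g x)%:E)%E.
  by rewrite integral_itv_obnd_cbnd//; exact: mgE.
have cvg : (\int[mu]_(x in `[r, (r + n%:R)%R]) (g x)%:E)%E @[n --> \oo] --> M%:E.
  rewrite -ME -ooE.
  rewrite itv_bndy_bigcup_BRight.
  apply: ge0_nondecreasing_set_cvg_integral => //.
  - move=> m n mn; apply/subsetPset; apply: subset_itvl.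
    by rewrite bnd_simp lerD2l ler_nat.
  - by move=> n; exact: mgE.
  - by move=> n x _; rewrite lee_fin.
(* By monotone convergence a bounded interval carries more than M - t. *)
have [n Mn] : exists n : nat,
    ((M - t)%:E < \int[mu]_(x in `[r, (r + n%:R)%R]) (g x)%:E)%E.
  apply: contrapT => /forallNP nex.
  have : (M%:E <= (M - t)%:E)%E.
    rewrite -(cvg_lim _ cvg)//; apply: lime_le; first by apply/cvg_ex; exists M%:E.
    by apply: nearW => n; rewrite leNgt; apply/negP/nex.
  by rewrite lee_fin lerBrDr gerDl leNgt t0.
have split_at s : r <= s -> (M%:E = \int[mu]_(x in `[r, s]) (g x)%:E +
    \int[mu]_(x in `]s, +oo[) (g x)%:E)%E.
  move=> rs; rewrite -ME -ooE -ge0_integral_setU//.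
  - by rewrite -itv_bndbnd_setU// bnd_simp.
  - exact: mgE.
  - by move=> x _; rewrite lee_fin.
  - apply/disj_setPS => x [/=]; rewrite !in_itv/= => /andP[_ xs]/andP[sx _].
    by have := le_lt_trans xs sx; rewrite ltxx.
have [||||c /andP[rc cn] cE] :=
  @integral_itv_ivt r (r + n%:R) (M - t).
- by rewrite lerDl.
- apply: (le_lt_trans _ (ltry M)).
  by rewrite (split_at (r + n%:R)) ?lerDl// leeDl.
- by rewrite subr_ge0 ltW.
- exact: ltW.
exists c; first exact: lt_le_trans rc.
have := split_at c rc; rewrite cE; case: (integral _ _ _) => //= z.
rewrite -EFinD => -[] Mz; congr EFin; lra.
Qed.

End interval_integrals.

Local Notation mu := lebesgue_measure.

Lemma posRE (R : realType) (x : R) : posR R x <-> 0 < x.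
Proof. by rewrite /posR/= in_itv/= andbT. Qed.

Lemma measurable_posR (R : realType) : measurable (posR R).
Proof. exact: measurable_itv. Qed.
#[local] Hint Extern 0 (measurable (posR _)) =>
  solve [apply: measurable_posR] : core.

Lemma open_posR (R : realType) : open (posR R).
Proof. exact: interval_open. Qed.

Lemma sub_posR (R : realType) (a : R) : 0 <= a -> `]a, +oo[ `<=` posR R.
Proof.
move=> a0 x/=; rewrite in_itv/= andbT => ax; apply/posRE.
exact: le_lt_trans ax.
Qed.

Lemma sub_posRl (R : realType) (a : R) : `]0, a[ `<=` posR R.
Proof. by move=> x/=; rewrite in_itv/= => /andP[x0 _]; apply/posRE. Qed.

(** Covers monotone functions on (0, oo), increasing or decreasing, which need
    not extend to monotone functions on the whole line. *)
Lemma measurable_fun_posR_interval (R : realType) (F : R -> R) :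
  (forall a, is_interval (posR R `&` [set s | a <= F s])) ->
  measurable_fun (posR R) F.
Proof.
move=> itvF; apply: (measurability (@RGenCInfty.G R)) => [|/= _ [_] [r] -> <-].
  exact: RGenCInfty.measurableE.
apply: is_interval_measurable; rewrite (_ : _ `&` _ = posR R `&` [set s | r <= F s])//.
by congr (_ `&` _); apply/seteqP; split => x/=; rewrite in_itv/= andbT.
Qed.

Lemma measurable_posR_nondecreasing (R : realType) (F : R -> R) :
  (forall r t, 0 < r -> r <= t -> F r <= F t) -> measurable_fun (posR R) F.
Proof.
move=> ndF; apply: measurable_fun_posR_interval => a r t [/posRE r0 /= aFr] _ z.
move=> /andP[rz _]; split; first by apply/posRE; exact: lt_le_trans rz.
by apply: le_trans aFr _; exact: ndF.
Qed.

Lemma measurable_posR_nonincreasing (R : realType) (F : R -> R) :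
  (forall r t, 0 < r -> r <= t -> F t <= F r) -> measurable_fun (posR R) F.
Proof.
move=> niF; apply: measurable_fun_posR_interval => a r t [/posRE r0 _].
move=> [_ /= aFt] z /andP[rz zt].
have z0 : 0 < z by exact: lt_le_trans rz.
by split; [exact/posRE | apply: le_trans aFt _; exact: niF].
Qed.

Lemma le_fine_integral (R : realType) (E E' : set R) (s f : R -> R) :
  measurable E -> measurable E' -> E `<=` E' -> E' `<=` posR R ->
  nonneg_measurable s -> measurable_fun (posR R) f ->
  (\int[mu]_(x in E') (s x * `|f x|)%:E < +oo)%E ->
  fine (\int[mu]_(x in E) (s x * `|f x|)%:E)%E <=
  fine (\int[mu]_(x in E') (s x * `|f x|)%:E)%E.
Proof.
move=> mE mE' EE' E'P [s0 ms] mf foo.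
have sf0 x : E' x -> (0 <= (s x * `|f x|)%:E)%E.
  by move=> /E'P/posRE x0; rewrite lee_fin mulr_ge0 ?s0.
have le : (\int[mu]_(x in E) (s x * `|f x|)%:E <=
    \int[mu]_(x in E') (s x * `|f x|)%:E)%E.
  apply: ge0_subset_integral => //; apply/measurable_EFinP.
  apply: (measurable_funS _ E'P) => //.
  by apply: measurable_funM => //; exact: measurableT_comp.
apply: (fine_le _ _ (le)); rewrite ?ge0_fin_numE//.
- exact: le_lt_trans le foo.
- by apply: integral_ge0 => x /EE'/sf0.
- exact: integral_ge0.
Qed.

(** Removing the null set {a} leaves the union of the two open intervals, on
    which g is nonnegative. *)
Lemma integral_posR_split (R : realType) (a : R) (g : R -> R) : 0 < a ->
  measurable_fun (posR R) g -> (forall x, 0 < x -> x != a -> 0 <= g x) ->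
  (\int[mu]_(x in posR R) (g x)%:E =
   \int[mu]_(x in `]0%R, a[) (g x)%:E + \int[mu]_(x in `]a, +oo[) (g x)%:E)%E.
Proof.
move=> a0 mg g0.
have PE : posR R `\ a = `]0, a[ `|` `]a, +oo[.
  apply/seteqP; split => [x [/posRE x0 /eqP]|x [|]]/=.
  - by rewrite neq_lt !in_itv/= x0 !andbT => /orP.
  - by rewrite in_itv/= => /andP[x0 xa]; split; [exact/posRE|apply/eqP; rewrite lt_eqF].
  - rewrite in_itv/= andbT => ax; split; first by apply/posRE; exact: lt_trans ax.
    by apply/eqP; rewrite gt_eqF.
have mPg : measurable_fun (posR R `\ a) (fun x => (g x)%:E).
  by apply/measurable_EFinP; apply: measurable_funS mg => // x [].
rewrite -(integral_setD1 (r := a))//; last exact: measurableD.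
rewrite PE in mPg *; rewrite ge0_integral_setU//.
- rewrite -PE => x [/posRE x0 /eqP xa]; rewrite lee_fin; exact: g0.
- apply/disj_setPS => x [/=]; rewrite !in_itv/= => /andP[_ xa] /andP[ax _].
  by have := lt_trans xa ax; rewrite ltxx.
Qed.

(** Dominated convergence along every sequence of truncation points that tends
    to infinity. *)
Lemma cvg_integral_truncation (R : realType) (g : R -> R) :
  mu.-integrable (posR R) (EFin \o g) ->
  (\int[mu]_(x in `]0, N[) g x) @[N --> +oo] --> \int[mu]_(x in posR R) g x.
Proof.
move=> ig; have mg := measurable_int _ ig; move/measurable_EFinP in mg.
apply/cvg_pinftyP => a aoo.
have aE n : (\int[mu]_(x in `]0%R, a n[) (g x)%:E =
    \int[mu]_(x in posR R) (cut `]0%R, a n[ g x)%:E)%E.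
  rewrite integral_cut [RHS]integral_cut; apply: eq_integral => x _.
  rewrite !patchE.
  by case: ifPn => [/set_mem/sub_posRl/mem_set ->//|_]; case: ifP.
apply: fine_cvg; rewrite /Rintegral fineK; last exact: integrable_fin_num.
suff cutg : (\int[mu]_(x in posR R) (cut `]0%R, a n[ g x)%:E)%E
    @[n --> \oo] --> (\int[mu]_(x in posR R) (g x)%:E)%E.
  by apply: cvg_trans cutg; apply: near_eq_cvg; apply: nearW => n; rewrite aE.
refine (@dominated_cvg _ _ R mu (posR R) _ (fun n x => (cut `]0, a n[ g x)%:E)
  (EFin \o g) (abse \o EFin \o g) _ _ _ _ _) => //.
- move=> n; apply/measurable_EFinP.
  apply: (measurable_funS measurableT) => //.
  apply: measurable_cut => //; apply: measurable_funS mg => //.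
  exact: sub_posRl.
- move=> x /posRE x0; apply: cvg_near_cst.
  have /cvgryPgt/(_ x) := aoo.
  apply: filterS => n xn; rewrite patchE mem_set//=.
  by rewrite in_itv/= x0.
- exact: integrable_abse.
- move=> n x _; rewrite lee_fin patchE; case: ifP => //.
  by rewrite normr0.
Qed.

(** * Weights and the change of variable *)

Lemma bijective_C1_gt0 (R : realType) (phi : R -> R) : bijective_C1 phi ->
  forall y, 0 < y -> 0 < phi y.
Proof. by move=> [[phiP _ _] _] y /posRE/phiP/posRE. Qed.

Lemma bijective_C1_measurable (R : realType) (phi : R -> R) :
  bijective_C1 phi -> measurable_fun (posR R) phi.
Proof.
move=> [_ dphi]; apply: open_continuous_measurable_fun; first exact: open_posR.
move=> x /set_mem/posRE/dphi[/derivable1_diffP dx _].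
exact: differentiable_continuous.
Qed.

Lemma measurable_inv_image (R : realType) (phi : R -> R) (B : set R) :
  bijective_C1 phi -> measurable B -> measurable (inv_image phi B).
Proof. by move=> hphi mB; apply: bijective_C1_measurable. Qed.

Lemma measurable_weightV (R : realType) (v : R -> R) : weight v ->
  measurable_fun (posR R) (fun x => (v x)^-1).
Proof.
move=> [v0 [mv _ _]].
have vE x : posR R x -> (v x)^-1 = v x `^ (-1).
  by move=> /posRE x0; rewrite powR_inv1// ltW// v0.
apply: eq_measurable_fun (measurableT_comp (measurable_powR _) mv) => x.
by move=> /set_mem/vE ->.
Qed.

Section weighted_hoelder.
Variables (R : realType) (p : \bar R) (v s f : R -> R) (E : set R).
Hypotheses (p1 : (1 < p)%E) (hv : weight v) (hs : nonneg_measurable s).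
Hypotheses (hf : wLp p v f) (mE : measurable E) (EP : E `<=` posR R).

Lemma measurable_quotient : measurable_fun (posR R) (fun x => s x * (v x)^-1).
Proof.
by apply: measurable_funM; [case: hs | exact: measurable_weightV].
Qed.

(** Hölder's inequality for s |f| = (s / v) (v |f|). *)
Lemma weighted_hoelder :
  (\int[mu]_(x in E) (s x * `|f x|)%:E <=
   norm_on (hoelder_conjugate p) E (fun x => (s x * (v x)^-1)%R) * wnorm p v f)%E.
Proof.
case: hv => v0 [mv _ _]; case: hs => s0 ms; case: hf => mf _.
apply: (@le_trans _ _
  (norm_on (hoelder_conjugate p) E (fun x => (s x * (v x)^-1)%R)
   * 'N[mu]_p[EFin \o cut E (fun x => v x * `|f x|)%R])%E); last first.
  by apply: lee_wpmul2l; [exact: Lnorm_ge0|apply: le_Lnorm_cut => //; exact: ltW].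
rewrite /norm_on; apply: (le_trans _ (hoelder_on (f := fun x => s x * (v x)^-1)
  (g := fun x => v x * `|f x|) mu p1 mE _ _)).
- rewrite le_eqVlt; apply/orP; left; apply/eqP; apply: eq_integral => x /set_mem.
  move=> /EP/posRE x0; have vx := v0 _ x0.
  rewrite normrM normfV (ger0_norm (s0 _ x0)) normrM normr_id (gtr0_norm vx).
  by rewrite mulrA divfK ?gt_eqF.
- exact: measurable_funS measurable_quotient.
- apply: (measurable_funS _ EP) => //.
  by apply: measurable_funM => //; exact: measurableT_comp.
Qed.

Lemma weighted_hoelder_lty :
  Lp_on (hoelder_conjugate p) E (fun x => s x * (v x)^-1) ->
  (\int[mu]_(x in E) (s x * `|f x|)%:E < +oo)%E.
Proof.
move=> [_ soo]; apply: le_lt_trans weighted_hoelder _; case: hf => _ foo.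
by rewrite lte_mul_pinfty ?ge0_fin_numE ?Lnorm_ge0.
Qed.

End weighted_hoelder.

(** * Two-sided bounds for the integral operator *)

Section kernel_operator.
Variables (R : realType) (p : \bar R) (v phi s1 s2 w1 w2 : R -> R).
Variables (K : R -> R -> R) (c C : R).
Hypotheses (p1 : (1 < p)%E) (hv : weight v).
Hypothesis phi_gt0 : forall y, 0 < y -> 0 < phi y.
Hypotheses (hs1 : nonneg_measurable s1) (hs2 : nonneg_measurable s2).
Hypotheses (hw1 : nonneg_measurable w1) (hw2 : nonneg_measurable w2).
Hypothesis mK :
  measurable_fun (posR R `*` posR R) (fun z : R * R => K z.1 z.2).
Hypotheses (c0 : 0 < c) (C0 : 0 < C).
Hypothesis hK : forall x y : R, 0 < x -> 0 < y ->
  (x < phi y -> c * (s1 x * w1 y) <= K x y <= C * (s1 x * w1 y)) /\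
  (phi y < x -> c * (s2 x * w2 y) <= K x y <= C * (s2 x * w2 y)).
Hypothesis hs1v : forall r : R, 0 < r ->
  Lp_on (hoelder_conjugate p) `]0, r[ (fun x => s1 x * (v x)^-1).
Hypothesis hs2v : forall r : R, 0 < r ->
  Lp_on (hoelder_conjugate p) `]r, +oo[ (fun x => s2 x * (v x)^-1).
Variable f : R -> R.
Hypothesis hf : wLp p v f.

Let F1 r := (\int[mu]_(x in `]0%R, r[) (s1 x * `|f x|)%:E)%E.
Let F2 r := (\int[mu]_(x in `]r, +oo[) (s2 x * `|f x|)%:E)%E.

Lemma left_integral_lty r : 0 < r -> (F1 r < +oo)%E.
Proof.
move=> r0; apply: (weighted_hoelder_lty p1 hv hs1 hf) => //; last exact: hs1v.
exact: sub_posRl.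
Qed.

Lemma right_integral_lty r : 0 < r -> (F2 r < +oo)%E.
Proof.
move=> r0; apply: (weighted_hoelder_lty p1 hv hs2 hf) => //; last exact: hs2v.
exact/sub_posR/ltW.
Qed.

Let mf : measurable_fun (posR R) f. Proof. by case: hf. Qed.

Let mKy y : 0 < y -> measurable_fun (posR R) (fun x => K x y).
Proof.
move=> y0; apply: (measurable_comp (F := posR R `*` posR R)
  (f := fun z : R * R => K z.1 z.2) (g := fun x => (x, y))) => //.
- exact: measurableX.
- by move=> _ [x x0 <-]; split => //=; apply/posRE.
- by apply: measurable_funTS; exact: pair2_measurable.
Qed.

Let mfK y : 0 < y -> measurable_fun (posR R) (fun x => f x * K x y).
Proof. by move=> y0; apply: measurable_funM => //; exact: mKy. Qed.

Let msf s E : nonneg_measurable s -> E `<=` posR R ->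
  measurable_fun E (fun x => (s x * `|f x|)%:E).
Proof.
move=> [_ ms] EP; apply/measurable_EFinP.
apply: (measurable_funS _ EP); first exact: measurable_posR.
by apply: measurable_funM => //; exact: measurableT_comp.
Qed.

Let s1E := (proj1 hs1). Let s2E := (proj1 hs2).
Let w1E := (proj1 hw1). Let w2E := (proj1 hw2).

(** Split at x = phi y and use the upper bound of K on each side. The lower
    bound of K is used too: it gives K >= 0, hence |K| = K. *)
Lemma kernel_integral_le y : 0 < y ->
  (\int[mu]_(x in posR R) `|f x * K x y|%:E <=
   (C * w1 y)%:E * F1 (phi y) + (C * w2 y)%:E * F2 (phi y))%E.
Proof.
move=> y0; have py := phi_gt0 y0.
rewrite (integral_posR_split py)//; last first.
  by apply: measurableT_comp => //; exact: mfK.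
apply: leeD.
- rewrite -ge0_integralZl//; last 3 first.
  + by apply: msf => //; exact: sub_posRl.
  + by move=> x /sub_posRl/posRE x0; rewrite lee_fin mulr_ge0// s1E.
  + by rewrite lee_fin mulr_ge0 ?w1E// ltW.
  apply: le_lower_integral => x; first by rewrite lee_fin.
  move=> /[dup] /sub_posRl/posRE x0; rewrite /= in_itv/= => /andP[_ xp].
  have [/(_ xp)/andP[Kl Ku] _] := hK x0 y0.
  have K0 : 0 <= K x y.
    by apply: le_trans Kl; rewrite !mulr_ge0 ?s1E ?w1E// ltW.
  rewrite lee_fin normrM (ger0_norm K0).
  rewrite [leRHS](_ : _ = `|f x| * (C * (s1 x * w1 y))); last by ring.
  exact: ler_wpM2l.
- rewrite -ge0_integralZl//; last 3 first.
  + by apply: msf => //; exact/sub_posR/ltW.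
  + move=> x /(sub_posR (ltW py))/posRE x0; by rewrite lee_fin mulr_ge0// s2E.
  + by rewrite lee_fin mulr_ge0 ?w2E// ltW.
  apply: le_lower_integral => x; first by rewrite lee_fin.
  move=> /[dup] /(sub_posR (ltW py))/posRE x0; rewrite /= in_itv/= andbT => xp.
  have [_ /(_ xp)/andP[Kl Ku]] := hK x0 y0.
  have K0 : 0 <= K x y.
    by apply: le_trans Kl; rewrite !mulr_ge0 ?s2E ?w2E// ltW.
  rewrite lee_fin normrM (ger0_norm K0).
  rewrite [leRHS](_ : _ = `|f x| * (C * (s2 x * w2 y))); last by ring.
  exact: ler_wpM2l.
Qed.

Let F1E y : 0 < y -> F1 (phi y) = (fine (F1 (phi y)))%:E.
Proof.
move=> y0; rewrite fineK// ge0_fin_numE ?left_integral_lty ?phi_gt0//.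
by apply: integral_ge0 => x /sub_posRl/posRE x0; rewrite lee_fin mulr_ge0// s1E.
Qed.

Let F2E y : 0 < y -> F2 (phi y) = (fine (F2 (phi y)))%:E.
Proof.
move=> y0; rewrite fineK// ge0_fin_numE ?right_integral_lty ?phi_gt0//.
apply: integral_ge0 => x /(sub_posR (ltW (phi_gt0 y0)))/posRE x0.
by rewrite lee_fin mulr_ge0// s2E.
Qed.

Lemma kernel_integrable y : 0 < y ->
  mu.-integrable (posR R) (EFin \o (fun x => f x * K x y)).
Proof.
move=> y0; apply/integrableP; split; first by apply/measurable_EFinP; exact: mfK.
apply: le_lt_trans (kernel_integral_le y0) _.
by rewrite F1E// F2E// -!EFinM -EFinD ltry.
Qed.

Lemma truncated_cvg y : 0 < y ->
  truncated K f y N @[N --> +oo] --> \int[mu]_(x in posR R) (f x * K x y).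
Proof. by move=> y0; exact: cvg_integral_truncation (kernel_integrable y0). Qed.

(** The half-line being one domain of integrability, all the conditions follow
    from [kernel_integrable]. *)
Lemma wLp_admissible : admissible K f.
Proof.
move=> y y0; split.
- exact: open_integrable_locally (@open_posR _) (kernel_integrable y0).
- move=> N N0; apply: integrableS (kernel_integrable y0) => //.
  exact: sub_posRl.
- by apply/cvg_ex; eexists; exact: truncated_cvg.
Qed.

Lemma transformE y : 0 < y ->
  transform K f y = \int[mu]_(x in posR R) (f x * K x y).
Proof. by move=> y0; apply/cvg_lim => //; exact: truncated_cvg. Qed.

Lemma transform_le y : 0 < y ->
  `|transform K f y| <= C * (w1 y * fine (F1 (phi y)) + w2 y * fine (F2 (phi y))).
Proof.
move=> y0; rewrite transformE// -lee_fin.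
have iK := kernel_integrable y0.
rewrite EFin_normr_Rintegral//.
apply: le_trans (le_abse_integral _ _ (measurable_int _ iK)) _ => //.
apply: le_trans (kernel_integral_le y0) _.
rewrite F1E// F2E// -!EFinM -EFinD lee_fin/= mulrDr !mulrA; exact: lexx.
Qed.

(** For f >= 0 the integral defining Tf splits into two nonnegative parts, and
    each of them is bounded below through the lower bound of K. *)
Lemma transform_ge y : 0 < y -> (forall x, 0 < x -> 0 <= f x) ->
  c * (w1 y * fine (F1 (phi y))) <= transform K f y /\
  c * (w2 y * fine (F2 (phi y))) <= transform K f y.
Proof.
move=> y0 f0; have py := phi_gt0 y0.
have lo1 x : x \in `]0, (phi y)[ -> (c * w1 y) * (s1 x * `|f x|) <= f x * K x y.
  rewrite in_itv/= => /andP[x0 xp].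
  have [/(_ xp)/andP[Kl _] _] := hK x0 y0; rewrite ger0_norm ?f0//.
  rewrite [leLHS](_ : _ = f x * (c * (s1 x * w1 y))); last by ring.
  by apply: ler_wpM2l => //; exact: f0.
have lo2 x : x \in `]phi y, +oo[ -> (c * w2 y) * (s2 x * `|f x|) <= f x * K x y.
  rewrite in_itv/= andbT => xp; have x0 := lt_trans py xp.
  have [_ /(_ xp)/andP[Kl _]] := hK x0 y0; rewrite ger0_norm ?f0//.
  rewrite [leLHS](_ : _ = f x * (c * (s2 x * w2 y))); last by ring.
  by apply: ler_wpM2l => //; exact: f0.
have cw1 : 0 <= c * w1 y by rewrite mulr_ge0 ?w1E// ltW.
have cw2 : 0 <= c * w2 y by rewrite mulr_ge0 ?w2E// ltW.
have I1 : (((c * w1 y) * fine (F1 (phi y)))%:E <=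
    \int[mu]_(x in `]0%R, phi y[) (f x * K x y)%:E)%E.
  rewrite EFinM -F1E// -ge0_integralZl//.
  - apply: le_lower_integral => x; last exact: lo1.
    by move=> /sub_posRl/posRE x0; rewrite lee_fin !mulr_ge0// ?s1E// ?w1E// ltW.
  - by apply: msf => //; exact: sub_posRl.
  - by move=> x /sub_posRl/posRE x0; rewrite lee_fin mulr_ge0// s1E.
have I2 : (((c * w2 y) * fine (F2 (phi y)))%:E <=
    \int[mu]_(x in `]phi y, +oo[) (f x * K x y)%:E)%E.
  rewrite EFinM -F2E// -ge0_integralZl//.
  - apply: le_lower_integral => x; last exact: lo2.
    move=> /(sub_posR (ltW py))/posRE x0.
    by rewrite lee_fin !mulr_ge0// ?s2E// ?w2E// ltW.
  - by apply: msf => //; exact/sub_posR/ltW.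
  - by move=> x /(sub_posR (ltW py))/posRE x0; rewrite lee_fin mulr_ge0// s2E.
have F1p : 0 <= fine (F1 (phi y)).
  by rewrite fine_ge0//; apply: integral_ge0 => x /sub_posRl/posRE x0;
    rewrite lee_fin mulr_ge0// s1E.
have F2p : 0 <= fine (F2 (phi y)).
  by rewrite fine_ge0//; apply: integral_ge0 => x /(sub_posR (ltW py))/posRE x0;
    rewrite lee_fin mulr_ge0// s2E.
have TE : ((transform K f y)%:E = \int[mu]_(x in `]0%R, phi y[) (f x * K x y)%:E +
     \int[mu]_(x in `]phi y, +oo[) (f x * K x y)%:E)%E.
  rewrite transformE// /Rintegral fineK; last first.
    exact: integrable_fin_num (kernel_integrable y0).
  rewrite (integral_posR_split py)//; first exact: mfK.
  move=> x x0; rewrite neq_lt => /orP[xp|xp].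
  - apply: le_trans (lo1 _ _); last by rewrite in_itv/= x0.
    by rewrite !mulr_ge0// ?s1E// ?w1E// ltW.
  - apply: le_trans (lo2 _ _); last by rewrite in_itv/= xp.
    by rewrite !mulr_ge0// ?s2E// ?w2E// ltW.
split; rewrite -lee_fin TE mulrA.
- apply: le_trans I1 _; rewrite leeDl//; apply: le_trans I2.
  by rewrite lee_fin mulr_ge0.
- apply: le_trans I2 _; rewrite leeDr//; apply: le_trans I1.
  by rewrite lee_fin mulr_ge0.
Qed.

End kernel_operator.

(** * Sufficiency and necessity for one half of the kernel *)

Section weighted_hardy.
Variables (R : realType) (p q : \bar R) (u v phi s w f : R -> R).
Variables (I J : R -> set R) (A : R).
Hypotheses (p1 : (1 < p)%E) (pq : (p <= q)%E).
Hypotheses (hu : weight u) (hv : weight v) (hphi : bijective_C1 phi).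
Hypotheses (hs : nonneg_measurable s) (hw : nonneg_measurable w).
Hypothesis hf : wLp p v f.
Hypothesis mI : forall r : R, 0 < r -> measurable (I r).
Hypotheses (mJ : forall r : R, 0 < r -> measurable (J r)).
Hypotheses (I_pos : forall r : R, 0 < r -> I r `<=` posR R).
Hypotheses (J_pos : forall r : R, 0 < r -> J r `<=` posR R).
Hypothesis I_chain : forall r t : R, 0 < r -> 0 < t ->
  I r `<=` I t \/ I t `<=` I r.
Hypothesis I_J : forall r y : R, 0 < r -> 0 < y -> ~ J r y -> I (phi y) `<=` I r.
Hypothesis I_ivt : forall g : R -> R, measurable_fun setT g ->
  (forall x, 0 <= g x) -> forall r t : R, 0 < r -> 0 < t ->
  (\int[mu]_(x in I r) (g x)%:E < +oo)%E ->
  (t%:E < \int[mu]_(x in I r) (g x)%:E)%E ->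
  exists2 r', 0 < r' & (\int[mu]_(x in I r') (g x)%:E = t%:E)%E.
Hypothesis hsv : forall r : R, 0 < r ->
  Lp_on (hoelder_conjugate p) (I r) (fun x => s x * (v x)^-1).

(** [hardy_chain] applied to sigma = s/v, h = v |f| and w u, all extended by
    zero to the whole line. *)
Lemma weighted_hardy :
  (forall r, 0 < r -> (norm_on q (J r) (fun y => (w y * u y)%R) *
    norm_on (hoelder_conjugate p) (I r) (fun x => (s x * (v x)^-1)%R) <= A%:E)%E) ->
  (norm_on q (posR R) (fun y => (w y * u y *
     fine (\int[mu]_(x in I (phi y)) (s x * `|f x|)%:E)%E)%R) <=
   (4 * A)%:E * wnorm p v f)%E.
Proof.
move=> hA; case: (hs) => s0 ms; case: (hw) => w0 mw; case: (hf) => mf _.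
case: (hv) => v0 [mv _ _]; case: (hu) => u0 [mru _ _].
pose sigma := cut (posR R) (fun x => s x * (v x)^-1).
pose h := cut (posR R) (fun x => v x * `|f x|).
pose wu := cut (posR R) (fun y => w y * u y).
have msigma : measurable_fun setT sigma.
  by apply: measurable_cut => //; exact: measurable_quotient.
have mh : measurable_fun setT h.
  apply: measurable_cut => //; apply: measurable_funM => //.
  exact: measurableT_comp.
have mwu : measurable_fun setT wu.
  by apply: measurable_cut => //; exact: measurable_funM.
have sigma0 x : 0 <= sigma x.
  apply: cut_ge0 => {}x /posRE x0; rewrite mulr_ge0 ?s0// invr_ge0 ltW//.
  exact: v0.
have h0 x : 0 <= h x.
  by apply: cut_ge0 => {}x /posRE x0; rewrite mulr_ge0// ltW// v0.
have wu0 x : 0 <= wu x.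
  by apply: cut_ge0 => {}x /posRE x0; rewrite mulr_ge0 ?w0// ltW// u0.
have FE r : 0 < r -> (\int[mu]_(x in I r) (s x * `|f x|)%:E =
    \int[mu]_(x in I r) (sigma x * h x)%:E)%E.
  move=> r0; apply: eq_integral => x /set_mem/(I_pos r0) Px.
  have /v0 vx : 0 < x by exact/posRE.
  by rewrite /sigma /h !patchE mem_set// mulrA divfK// gt_eqF.
have Foo r : 0 < r -> (\int[mu]_(x in I r) (sigma x * h x)%:E < +oo)%E.
  move=> r0; rewrite -FE//; apply: (weighted_hoelder_lty p1 hv hs hf) => //.
  - exact: mI.
  - exact: I_pos.
  - exact: hsv.
have phi0 := bijective_C1_gt0 hphi.
have key := @hardy_chain _ _ _ _ R mu mu p q sigma h wu phi I J (posR R) A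
  p1 pq msigma mh sigma0 h0 mwu wu0 mI mJ.
have {key} := key _ Foo I_chain _ _ _.
rewrite (_ : cut (posR R) _ = cut (posR R) (fun y => (w y * u y *
     fine (\int[mu]_(x in I (phi y)) (s x * `|f x|)%:E)%E)%R)); last first.
  apply/funext => y; rewrite !patchE; case: ifPn => // /[dup] yP /set_mem/posRE y0.
  by rewrite /wu patchE yP FE// phi0.
apply.
- by move=> y /posRE; exact: phi0.
- by move=> r y r0 /posRE y0; exact: I_J.
- move=> r t r0 t0; apply: (I_ivt _ _ r0 t0); last exact: Foo.
  + exact: measurable_funM.
  + by move=> x; rewrite mulr_ge0.
- move=> r r0; rewrite /wu /sigma !cut_sub; [exact: hA|exact: I_pos|exact: J_pos].
Qed.

End weighted_hardy.

Section necessity.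
Variables (R : realType) (p q : \bar R) (u v s w : R -> R) (K : R -> R -> R).
Variables (I J : R -> set R) (c C : R).
Hypotheses (p1 : (1 < p)%E) (q1 : (1 <= q)%E).
Hypotheses (hu : weight u) (hv : weight v).
Hypotheses (hs : nonneg_measurable s) (hw : nonneg_measurable w).
Hypotheses (mI : forall r : R, 0 < r -> measurable (I r)).
Hypotheses (mJ : forall r : R, 0 < r -> measurable (J r)).
Hypotheses (I_pos : forall r : R, 0 < r -> I r `<=` posR R).
Hypotheses (J_pos : forall r : R, 0 < r -> J r `<=` posR R).
Hypothesis hsv : forall r : R, 0 < r ->
  Lp_on (hoelder_conjugate p) (I r) (fun x => s x * (v x)^-1).
Hypotheses (c0 : 0 < c) (C0 : 0 < C).
Hypothesis K_lower : forall f r y, wLp p v f -> (forall x, 0 < x -> 0 <= f x) ->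
  0 < r -> J r y ->
  c * (w y * fine (\int[mu]_(x in I r) (s x * `|f x|)%:E)%E) <= transform K f y.
Hypothesis K_bounded : forall f, wLp p v f ->
  (wnorm q u (transform K f) <= C%:E * wnorm p v f)%E.

(** With h the extremal for s/v on I r, the test function h/v has weighted norm
    |h|_p <= L, while its transform is at least c w V L on J r. The factor L
    cancels and |w u|_{q, J r} V <= C / c remains. If V = 0 the product is 0,
    even when the other norm is infinite. *)
Lemma muckenhoupt_necessary r : 0 < r ->
  (norm_on q (J r) (fun y => (w y * u y)%R) *
   norm_on (hoelder_conjugate p) (I r) (fun x => (s x * (v x)^-1)%R) <=
   (C / c)%:E)%E.
Proof.
move=> r0; case: (hs) => s0 ms; case: (hw) => w0 mw.
case: (hv) => v0 [mv _ _]; case: (hu) => u0 [mru _ _].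
have [_ Voo] := hsv r0.
have [V VE] : exists V : R, norm_on (hoelder_conjugate p) (I r)
    (fun x => s x * (v x)^-1) = V%:E.
  exists (fine (norm_on (hoelder_conjugate p) (I r) (fun x => s x * (v x)^-1))).
  by rewrite fineK// ge0_fin_numE// Lnorm_ge0.
have : 0 <= V by rewrite -lee_fin -VE Lnorm_ge0.
rewrite VE le_eqVlt => /predU1P[<-|V0].
  by rewrite mule0 lee_fin divr_ge0 ?ltW.
have Ix x : I r x -> 0 < x by move=> /(I_pos r0)/posRE.
have msv : measurable_fun (I r) (fun x => s x * (v x)^-1).
  exact: measurable_funS (I_pos r0) (measurable_quotient hv hs).
have [|h [L [mh h0 L0 hL hV]]] :=
  @hoelder_extremal _ _ R mu p (I r) (fun x => s x * (v x)^-1) V p1 (mI r0) msv _ V0 VE.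
  by move=> x /Ix x0; rewrite mulr_ge0 ?s0// invr_ge0 ltW// v0.
pose f := cut (I r) (fun x => h x / v x).
have f0 x : 0 <= f x.
  by apply: cut_ge0 => {}x /Ix x0; rewrite divr_ge0// ltW// v0.
have hfE : (fun x => v x * `|f x|) = cut (I r) h.
  apply/funext => x; rewrite /f !patchE; case: ifPn => [/set_mem/Ix x0|_].
    have vx := v0 _ x0.
    by rewrite ger0_norm ?divr_ge0 ?(ltW vx)// mulrC divfK ?gt_eqF.
  by rewrite normr0 mulr0.
have fnorm : (wnorm p v f <= L%:E)%E.
  rewrite /wnorm /norm_on hfE; apply: le_trans hL.
  apply: Lnorm_ler; first exact: ltW.
  by move=> x; rewrite [leLHS]/= patchE; case: ifP => //; rewrite normr0.
have hf : wLp p v f.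
  split; last exact: le_lt_trans fnorm (ltry _).
  apply: measurable_funTS; apply: measurable_cut; first exact: mI.
  apply: measurable_funM => //.
  exact: measurable_funS (I_pos r0) (measurable_weightV hv).
have Iint : (\int[mu]_(x in I r) (s x * `|f x|)%:E = (V * L)%:E)%E.
  rewrite -hV; apply: eq_integral => x /[dup] xI /set_mem/Ix x0.
  by rewrite ger0_norm// /f patchE xI mulrA mulrAC.
have lower : ((c * (V * L))%:E * norm_on q (J r) (fun y => (w y * u y)%R) <=
    wnorm q u (transform K f))%E.
  rewrite /norm_on -LnormZ_ge0 ?mulr_gt0//; last first.
    apply: measurable_cut; first exact: mJ.
    by apply: (measurable_funS _ (J_pos r0)) => //; exact: measurable_funM.
  apply: Lnorm_ler => // y; rewrite !patchE.
  case: ifPn => [/set_mem Jy|_]; last by rewrite mulr0 normr0.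
  have /posRE y0 := J_pos r0 Jy.
  rewrite mem_set; last exact/posRE.
  have := K_lower hf (fun x _ => f0 x) r0 Jy; rewrite Iint/= => low.
  have wy := w0 _ y0; have uy := u0 _ y0.
  have T0 : 0 <= transform K f y.
    by apply: le_trans low; rewrite !mulr_ge0// ltW// mulr_gt0.
  rewrite !ger0_norm ?mulr_ge0 ?(ltW uy)// ?(ltW c0)// ?(ltW V0)// ?(ltW L0)//.
  rewrite mulrA mulrC ler_pM2l//; apply: le_trans low.
  by rewrite -mulrA [_ * w y]mulrC.
have := le_trans lower (le_trans (K_bounded hf) (lee_wpmul2l _ fnorm)).
rewrite lee_fin (ltW C0) => /(_ isT).
have cVL : 0 < c * (V * L) by rewrite !mulr_gt0.
case: (norm_on q (J r) _) => [n||].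
- rewrite -!EFinM !lee_fin => le.
  rewrite ler_pdivlMr// -(ler_pM2r L0); apply: le_trans le.
  by rewrite le_eqVlt; apply/orP; left; apply/eqP; ring.
- by rewrite gt0_muley ?lte_fin// -EFinM leye_eq.
- by move=> _; rewrite gt0_mulNye ?lte_fin// leNye.
Qed.

End necessity.

(** * The characterization *)

Lemma ereal_sup_ltyP (R : realType) (X : R -> \bar R) :
  (forall r, 0 < r -> (0 <= X r)%E) ->
  (ereal_sup [set X r | r in posR R] < +oo)%E <->
  exists2 A : R, 0 <= A & forall r, 0 < r -> (X r <= A%:E)%E.
Proof.
move=> X0; split => [supX|[A _ XA]].
  have sup0 : (0 <= ereal_sup [set X r | r in posR R])%E.
    apply: le_trans (X0 1 ltr01) _; apply: ereal_sup_ubound.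
    by exists 1 => //; apply/posRE.
  exists (fine (ereal_sup [set X r | r in posR R])); first exact: fine_ge0.
  move=> r r0; rewrite fineK ?ge0_fin_numE//; apply: ereal_sup_ubound.
  by exists r => //; apply/posRE.
apply: le_lt_trans (ltry A); apply: ge_ereal_sup => _ [r /posRE r0 <-].
exact: XA.
Qed.

Theorem corollary4p3 (R : realType) (p q : \bar R) (u v phi : R -> R)
    (s1 s2 w1 w2 : R -> R) (K : R -> R -> R)
    (hp : (1 < p)%E) (hpq : (p <= q)%E)
    (hu : weight u) (hv : weight v) (hphi : bijective_C1 phi)
    (hs1 : nonneg_measurable s1) (hs2 : nonneg_measurable s2)
    (hw1 : nonneg_measurable w1) (hw2 : nonneg_measurable w2)
    (hKmeas : measurable_fun (posR R `*` posR R) (fun z : R * R => K z.1 z.2))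
    (hK : kernel_equiv K phi s1 s2 w1 w2)
    (hs1v : forall r : R, 0 < r ->
      Lp_on (hoelder_conjugate p) `]0, r[ (fun x => s1 x * (v x)^-1))
    (hs2v : forall r : R, 0 < r ->
      Lp_on (hoelder_conjugate p) `]r, +oo[ (fun x => s2 x * (v x)^-1)) :
  weighted_inequality p q u v K <->
  (ereal_sup [set (norm_on q (inv_image phi `]r, +oo[) (fun y => w1 y * u y)%R *
                   norm_on (hoelder_conjugate p) `]0%R, r[
                     (fun x => s1 x * (v x)^-1)%R)%E
             | r in posR R] < +oo)%E /\
  (ereal_sup [set (norm_on q (inv_image phi `]0%R, r[) (fun y => w2 y * u y)%R *
                   norm_on (hoelder_conjugate p) `]r, +oo[
                     (fun x => s2 x * (v x)^-1)%R)%E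
             | r in posR R] < +oo)%E.
Proof.
have phi0 := bijective_C1_gt0 hphi; have mphi := bijective_C1_measurable hphi.
have q1 : (1 <= q)%E by rewrite (le_trans _ hpq)// ltW.
have [c [C [c0 C0 hKb]]] := hK.
have mI1 (r : R) : 0 < r -> measurable (`]0, r[ : set R) by [].
have mI2 (r : R) : 0 < r -> measurable (`]r, +oo[ : set R) by [].
have mJ1 (r : R) : 0 < r -> measurable (inv_image phi `]r, +oo[).
  by move=> _; exact: measurable_inv_image.
have mJ2 (r : R) : 0 < r -> measurable (inv_image phi `]0, r[).
  by move=> _; exact: measurable_inv_image.
have I1P (r : R) : 0 < r -> `]0, r[ `<=` posR R by move=> _; exact: sub_posRl.
have I2P (r : R) : 0 < r -> `]r, +oo[ `<=` posR R by move=> r0; exact/sub_posR/ltW.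
have JP (B : set R) : inv_image phi B `<=` posR R by move=> y [].
have sub1 (r t : R) : r <= t -> `]0, r[ `<=` (`]0, t[ : set R).
  by move=> rt; apply: subset_itvl; rewrite bnd_simp.
have sub2 (r t : R) : r <= t -> `]t, +oo[ `<=` (`]r, +oo[ : set R).
  by move=> rt; apply: subset_itvr; rewrite bnd_simp.
have mono1 f r t : wLp p v f -> 0 < r -> r <= t ->
    fine (\int[mu]_(x in `]0%R, r[) (s1 x * `|f x|)%:E)%E <=
    fine (\int[mu]_(x in `]0%R, t[) (s1 x * `|f x|)%:E)%E.
  move=> hf r0 rt; have t0 := lt_le_trans r0 rt.
  apply: (le_fine_integral _ _ (sub1 _ _ rt) (I1P _ t0) hs1) => //.
    by case: hf.
  exact: (left_integral_lty hp hv hs1 hs1v hf t0).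
have mono2 f r t : wLp p v f -> 0 < r -> r <= t ->
    fine (\int[mu]_(x in `]t, +oo[) (s2 x * `|f x|)%:E)%E <=
    fine (\int[mu]_(x in `]r, +oo[) (s2 x * `|f x|)%:E)%E.
  move=> hf r0 rt.
  apply: (le_fine_integral _ _ (sub2 _ _ rt) (I2P _ r0) hs2) => //.
    by case: hf.
  exact: (right_integral_lty hp hv hs2 hs2v hf r0).
rewrite !ereal_sup_ltyP; last 2 first.
- by move=> r _; rewrite mule_ge0// Lnorm_ge0.
- by move=> r _; rewrite mule_ge0// Lnorm_ge0.
split=> [[B [B0 hB]]|[[A1 A10 hA1] [A2 A20 hA2]]].
- have hB' f : wLp p v f -> (wnorm q u (transform K f) <= B%:E * wnorm p v f)%E.
    move=> hf; apply: hB => //.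
    exact: (wLp_admissible hp hv phi0 hs1 hs2 hw1 hw2 hKmeas c0 C0 hKb).
  have low f y : wLp p v f -> 0 < y -> (forall x, 0 < x -> 0 <= f x) ->
      c * (w1 y * fine (\int[mu]_(x in `]0%R, (phi y)[) (s1 x * `|f x|)%:E)%E)
        <= transform K f y /\
      c * (w2 y * fine (\int[mu]_(x in `]phi y, +oo[) (s2 x * `|f x|)%:E)%E)
        <= transform K f y.
    by move=> hf y0 f0; exact: (transform_ge hp hv phi0 hs1 hs2 hw1 hw2 hKmeas
      c0 C0 hKb).
  have Bc0 : 0 <= B / c by rewrite divr_ge0// ltW.
  split; exists (B / c) => // r r0.
  + apply: (@muckenhoupt_necessary R p q u v s1 w1 K (fun r => `]0, r[%classic)
      (fun r => inv_image phi `]r, +oo[) c B hp q1 hu hv hs1 hw1 mI1 mJ1 I1P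
      (fun r _ => @JP _) hs1v c0 B0 _ hB' r r0) => f t y hf f0 t0.
    move=> [/posRE y0 /=]; rewrite in_itv/= andbT => tpy.
    have [lo _] := low f y hf y0 f0; apply: le_trans lo.
    rewrite ler_pM2l// ler_wpM2l//; first by case: hw1 => + _; apply.
    by apply: mono1 => //; exact: ltW.
  + apply: (@muckenhoupt_necessary R p q u v s2 w2 K (fun r => `]r, +oo[%classic)
      (fun r => inv_image phi `]0, r[) c B hp q1 hu hv hs2 hw2 mI2 mJ2 I2P
      (fun r _ => @JP _) hs2v c0 B0 _ hB' r r0) => f t y hf f0 t0.
    move=> [/posRE y0 /=]; rewrite in_itv/= => /andP[_ tpy].
    have [_ lo] := low f y hf y0 f0; apply: le_trans lo.
    rewrite ler_pM2l// ler_wpM2l//; first by case: hw2 => + _; apply.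
    by apply: mono2 => //; [exact: phi0 | exact: ltW].
(* The summand 1 makes the constant positive when A1 = A2 = 0. *)
exists (C * (4 * A1 + 4 * A2) + 1); split.
  by rewrite ltr_wpDl// mulr_ge0 ?addr_ge0 ?mulr_ge0// ltW.
move=> f hf _.
pose F1 r := (\int[mu]_(x in `]0%R, r[) (s1 x * `|f x|)%:E)%E.
pose F2 r := (\int[mu]_(x in `]r, +oo[) (s2 x * `|f x|)%:E)%E.
have H1 : (norm_on q (posR R) (fun y => (w1 y * u y * fine (F1 (phi y)))%R) <=
   (4 * A1)%:E * wnorm p v f)%E.
  apply: (@weighted_hardy _ _ _ _ _ _ _ _ _ (fun r => `]0, r[%classic)
    (fun r => inv_image phi `]r, +oo[)) => //.
  - move=> r t _ _; have [rt|tr] := leP r t; [left|right]; apply: sub1 => //.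
    exact: ltW.
  - move=> r y r0 y0 nJ; apply: sub1; rewrite leNgt; apply/negP => rp; apply: nJ.
    by split; [exact/posRE | rewrite /= in_itv/= rp].
  - by move=> g mg g0 r t; exact: integral_left_ivt.
have H2 : (norm_on q (posR R) (fun y => (w2 y * u y * fine (F2 (phi y)))%R) <=
   (4 * A2)%:E * wnorm p v f)%E.
  apply: (@weighted_hardy _ _ _ _ _ _ _ _ _ (fun r => `]r, +oo[%classic)
    (fun r => inv_image phi `]0, r[)) => //.
  - move=> r t _ _; have [rt|tr] := leP r t; [right|left]; apply: sub2 => //.
    exact: ltW.
  - move=> r y r0 y0 nJ; apply: sub2; rewrite leNgt; apply/negP => rp; apply: nJ.
    by split; [exact/posRE | rewrite /= in_itv/= rp phi0].
  - by move=> g mg g0 r t; exact: integral_right_ivt.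
have mwu (w F : R -> R) : nonneg_measurable w -> measurable_fun (posR R) F ->
    measurable_fun setT (cut (posR R) (fun y => w y * u y * F (phi y))).
  move=> [_ mw] mF; apply: measurable_cut => //; apply: measurable_funM.
    by apply: measurable_funM => //; case: hu => _ [].
  apply: (measurable_comp (F := posR R) (f := F)) => //.
  by move=> _ [y /posRE y0 <-]; apply/posRE; exact: phi0.
pose G1 := cut (posR R) (fun y => w1 y * u y * fine (F1 (phi y))).
pose G2 := cut (posR R) (fun y => w2 y * u y * fine (F2 (phi y))).
have mG1 : measurable_fun setT G1.
  apply: (mwu w1 (fun r => fine (F1 r))) => //.
  by apply: measurable_posR_nondecreasing => r t r0 rt; exact: mono1.
have mG2 : measurable_fun setT G2.
  apply: (mwu w2 (fun r => fine (F2 r))) => //.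
  by apply: measurable_posR_nonincreasing => r t r0 rt; exact: mono2.
have [n nE] : exists n : R, wnorm p v f = n%:E.
  exists (fine (wnorm p v f)); rewrite fineK// ge0_fin_numE ?Lnorm_ge0//.
  by case: hf.
have n0 : 0 <= n by rewrite -lee_fin -nE Lnorm_ge0.
(* Only the majorant G1 + G2 has to be measurable in Minkowski's inequality. *)
apply: (@le_trans _ _ ('N[mu]_q[EFin \o (fun y => C * (G1 \+ G2) y)%R])%E).
  apply: Lnorm_ler => // y; rewrite /G1 /G2 /= !patchE.
  case: ifPn => [/set_mem/posRE y0|_]; last by rewrite addr0 mulr0.
  have uy : 0 < u y by case: hu => + _; apply.
  have := transform_le hp hv phi0 hs1 hs2 hw1 hw2 hKmeas c0 C0 hKb hs1v hs2v hf
    y0.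
  rewrite -/(F1 _) -/(F2 _) => Tle.
  rewrite normrM normr_id (gtr0_norm uy); apply: le_trans (ler_norm _).
  apply: le_trans (ler_wpM2l (ltW uy) Tle) _.
  rewrite le_eqVlt; apply/orP; left; apply/eqP; ring.
rewrite LnormZ_ge0//; last exact: measurable_funD.
apply: le_trans (lee_wpmul2l _ (eminkowski mu mG1 mG2 q1)) _.
  by rewrite lee_fin ltW.
apply: le_trans (lee_wpmul2l _ (leeD H1 H2)) _; first by rewrite lee_fin ltW.
rewrite nE -!EFinM lee_fin.
by rewrite -mulrDl mulrA ler_wpM2r// lerDl.
Qed.
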